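(* Let $G$ and $H$ be groups and let $F: G\to H$ and $F':\mathrm{Aut}(G)\to \mathrm{Aut}(H)$ be group homomorphisms. The map of sets $F'':\mathrm{Hol}(G)\to\mathrm{Hol}(H)$ defined by $$F''((f,x))=(F'(f),F(x))$$ is a group homomorphism if and only if $F$ and $F'$ are compatible. In this case $(F,F'',F')$ is a map of split extensions from $$1\to G\xrightarrow{i_1}\mathrm{Hol}(G)\xrightarrow{j_1}\mathrm{Aut}(G)\to 1\quad(\text{section } s_1)$$ to $$1\to H\xrightarrow{i_2}\mathrm{Hol}(H)\xrightarrow{j_2}\mathrm{Aut}(H)\to 1\quad(\text{section } s_2).$$ Conversely, for any map of split extensions $(F,F'',F')$ between these two split extensions, $F$ and $F'$ must be compatible and $F''$ is given by $F''((f,x))=(F'(f),F(x))$.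
   Context: For a group $K$, the holomorph $\mathrm{Hol}(K)$ is the group whose elements are pairs $(f,x)$ with $f\in\mathrm{Aut}(K)$, $x\in K$, with multiplication $(f,x)(g,y)=(fg,\,g^{-1}(x)y)$. It fits in the split extension $1\to K\xrightarrow{i}\mathrm{Hol}(K)\xrightarrow{j}\mathrm{Aut}(K)\to1$ with $i(x)=(1,x)$, $j((f,x))=f$ and section $s(f)=(f,1)$; the maps $i_1,j_1,s_1$ (resp. $i_2,j_2,s_2$) are these maps for $K=G$ (resp. $K=H$). Homomorphisms $F:G\to H$ and $F':\mathrm{Aut}(G)\to\mathrm{Aut}(H)$ are called compatible if $F'(g)(F(x))=F(g(x))$ for every $x\in G$ and every $g\in\mathrm{Aut}(G)$. A map of split extensions is a triple of group homomorphisms $(F,F'',F')$ with $F''i_1=i_2F$, $j_2F''=F'j_1$ and $F''s_1=s_2F'$. *)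

(* Defs.v *)
(* groupType is MathComp's structure for groups, finite or infinite.  Classical
   axioms (boolp) provide extensional equality in Aut K, the choice structures
   on Aut K and Hol K that groupType requires, and inverses of bijections. *)
From HB Require Import structures.
From mathcomp Require Import all_boot.
From mathcomp Require Import boolp.

Set Implicit Arguments.
Unset Strict Implicit.
Unset Printing Implicit Defensive.

Local Open Scope group_scope.

(* Equality in Aut K is pointwise equality: see aut_ext. *)
Record Aut (K : groupType) := MkAut {
  aut_hom :> {multiplicative K -> K};
  aut_bij : bijective aut_hom
}.

Section AutGroup.
Variable K : groupType.

Lemma aut_ext (f g : Aut K) : f =1 g -> f = g.
Proof.
case: f g => [[f [[mf]]] bf] [[g [[mg]]] bg] /= fg.
have e : f = g by apply/funext.
subst g; rewrite (Prop_irrelevance mg mf) in bg *.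
by rewrite (Prop_irrelevance bg bf).
Qed.

HB.instance Definition _ := gen_eqMixin (Aut K).
HB.instance Definition _ := gen_choiceMixin (Aut K).

Definition aut_one : Aut K :=
  @MkAut K idfun (Bijective (fun=> erefl) (fun=> erefl)).

Definition aut_mul (f g : Aut K) : Aut K :=
  @MkAut K (f \o g) (bij_comp (aut_bij f) (aut_bij g)).

Lemma aut_inverse_ex (f : Aut K) : exists f', cancel f f' /\ cancel f' f.
Proof. by case: (aut_bij f) => f' fK f'K; exists f'. Qed.

Definition aut_inv_fun (f : Aut K) : K -> K := sval (cid (aut_inverse_ex f)).

Lemma aut_funK (f : Aut K) : cancel f (aut_inv_fun f).
Proof. by rewrite /aut_inv_fun; case: cid => f' []. Qed.

Lemma aut_inv_funK (f : Aut K) : cancel (aut_inv_fun f) f.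
Proof. by rewrite /aut_inv_fun; case: cid => f' []. Qed.

HB.instance Definition _ (f : Aut K) :=
  isMultiplicative.Build K K (aut_inv_fun f)
    (can2_gmulfM (aut_funK f) (aut_inv_funK f)).

Definition aut_inv (f : Aut K) : Aut K :=
  @MkAut K (aut_inv_fun f) (Bijective (aut_inv_funK f) (aut_funK f)).

Lemma aut_mulA : associative aut_mul.
Proof. by move=> f g h; apply: aut_ext. Qed.

Lemma aut_mul1 : left_id aut_one aut_mul.
Proof. by move=> f; apply: aut_ext. Qed.

Lemma aut_mulr1 : right_id aut_one aut_mul.
Proof. by move=> f; apply: aut_ext. Qed.

Lemma aut_mulV : left_inverse aut_one aut_inv aut_mul.
Proof. by move=> f; apply: aut_ext => x; apply: aut_funK. Qed.

Lemma aut_mulrV : right_inverse aut_one aut_inv aut_mul.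
Proof. by move=> f; apply: aut_ext => x; apply: aut_inv_funK. Qed.

HB.instance Definition _ := isGroup.Build (Aut K)
  aut_mulA aut_mul1 aut_mulr1 aut_mulV aut_mulrV.

Lemma autM (f g : Aut K) x : (f * g) x = f (g x).
Proof. by []. Qed.

Lemma aut1 x : (1 : Aut K) x = x.
Proof. by []. Qed.

Lemma autK (f : Aut K) : cancel f (f^-1).
Proof. exact: aut_funK. Qed.

Lemma autVK (f : Aut K) : cancel (f^-1) f.
Proof. exact: aut_inv_funK. Qed.

Lemma aut_at1 (f : Aut K) : f 1 = 1.
Proof. by apply: (mulgI (f 1)); rewrite -gmulfM !mulg1. Qed.

End AutGroup.

(* A record rather than the product type Aut K * K, on which MathComp already
   puts the direct-product group structure. *)
Record Hol (K : groupType) := HolPair { hol_aut : Aut K; hol_elt : K }.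

Section HolGroup.
Variable K : groupType.

HB.instance Definition _ := gen_eqMixin (Hol K).
HB.instance Definition _ := gen_choiceMixin (Hol K).

Definition hol_one : Hol K := HolPair 1 1.

Definition hol_mul (p q : Hol K) : Hol K :=
  HolPair (hol_aut p * hol_aut q) ((hol_aut q)^-1 (hol_elt p) * hol_elt q).

Definition hol_inv (p : Hol K) : Hol K :=
  HolPair (hol_aut p)^-1 (hol_aut p (hol_elt p)^-1).

Lemma hol_mulE (f g : Aut K) (x y : K) :
  hol_mul (HolPair f x) (HolPair g y) = HolPair (f * g) (g^-1 x * y).
Proof. by []. Qed.

Lemma hol_mulA : associative hol_mul.
Proof.
move=> [f x] [g y] [h z]; rewrite !hol_mulE !mulgA gmulfM.
by have -> : (g * h)^-1 x = h^-1 (g^-1 x) by rewrite invgM.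
Qed.

Lemma hol_mul1 : left_id hol_one hol_mul.
Proof. by move=> [f x]; rewrite hol_mulE !mul1g aut_at1 mul1g. Qed.

Lemma hol_mulr1 : right_id hol_one hol_mul.
Proof. by move=> [f x]; rewrite hol_mulE !mulg1 invg1. Qed.

Lemma hol_mulV : left_inverse hol_one hol_inv hol_mul.
Proof. by move=> [f x]; rewrite hol_mulE mulVg autK mulVg. Qed.

Lemma hol_mulrV : right_inverse hol_one hol_inv hol_mul.
Proof.
by move=> [f x]; rewrite hol_mulE mulgV invgK -gmulfM mulgV aut_at1.
Qed.

HB.instance Definition _ := isGroup.Build (Hol K)
  hol_mulA hol_mul1 hol_mulr1 hol_mulV hol_mulrV.

Lemma holM (f g : Aut K) (x y : K) :
  HolPair f x * HolPair g y = HolPair (f * g) (g^-1 x * y).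
Proof. by []. Qed.

End HolGroup.

(* Split extensions 1 -> K -> E -> Q -> 1 with a chosen homomorphic section;
   surjectivity of the projection follows from ext_secK. *)
Record splitExt (K E Q : groupType) := SplitExt {
  ext_inj : {multiplicative K -> E};
  ext_proj : {multiplicative E -> Q};
  ext_sec : {multiplicative Q -> E};
  ext_injI : injective ext_inj;
  ext_exact : forall e : E, ext_proj e = 1 <-> exists x : K, ext_inj x = e;
  ext_secK : cancel ext_sec ext_proj
}.

Record split_ext_map (K1 E1 Q1 K2 E2 Q2 : groupType)
    (X1 : splitExt K1 E1 Q1) (X2 : splitExt K2 E2 Q2)
    (F : K1 -> K2) (F'' : E1 -> E2) (F' : Q1 -> Q2) : Prop := SplitExtMap {
  sem_kerM : {morph F : x y / x * y};
  sem_midM : {morph F'' : x y / x * y};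
  sem_quoM : {morph F' : x y / x * y};
  sem_inj : forall x, F'' (ext_inj X1 x) = ext_inj X2 (F x);
  sem_proj : forall e, ext_proj X2 (F'' e) = F' (ext_proj X1 e);
  sem_sec : forall q, F'' (ext_sec X1 q) = ext_sec X2 (F' q)
}.

Section HolSplitExt.
Variable K : groupType.

Definition hol_i (x : K) : Hol K := HolPair 1 x.
Definition hol_j (p : Hol K) : Aut K := hol_aut p.
Definition hol_s (f : Aut K) : Hol K := HolPair f 1.

Lemma hol_iM : {morph hol_i : x y / x * y}.
Proof. by move=> x y; rewrite /hol_i holM mulg1 invg1. Qed.

Lemma hol_jM : {morph hol_j : p q / p * q}.
Proof. by []. Qed.

Lemma hol_sM : {morph hol_s : f g / f * g}.
Proof. by move=> f g; rewrite /hol_s holM aut_at1 mulg1. Qed.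

HB.instance Definition _ := isMultiplicative.Build K (Hol K) hol_i hol_iM.
HB.instance Definition _ := isMultiplicative.Build (Hol K) (Aut K) hol_j hol_jM.
HB.instance Definition _ := isMultiplicative.Build (Aut K) (Hol K) hol_s hol_sM.

Lemma hol_iI : injective hol_i.
Proof. by move=> x y []. Qed.

Lemma hol_exact (p : Hol K) : hol_j p = 1 <-> exists x : K, hol_i x = p.
Proof.
split=> [|[x <-]//]; case: p => f x; rewrite /hol_j /= => ->.
by exists x.
Qed.

Lemma hol_sK : cancel hol_s hol_j.
Proof. by []. Qed.

Definition hol_ext : splitExt K (Hol K) (Aut K) :=
  @SplitExt K (Hol K) (Aut K) hol_i hol_j hol_s hol_iI hol_exact hol_sK.

End HolSplitExt.

Definition compatible (G H : groupType) (F : G -> H) (F' : Aut G -> Aut H) :=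
  forall (x : G) (g : Aut G), F' g (F x) = F (g x).

Definition hol_map (G H : groupType) (F : G -> H) (F' : Aut G -> Aut H)
    (p : Hol G) : Hol H :=
  HolPair (F' (hol_aut p)) (F (hol_elt p)).

(* Main.v *)
(* Every element of the holomorph factors as (f, x) = s(f) i(x), so a map of
   split extensions is determined by F and F'.  Compatibility is what
   multiplicativity of F'' says on the products i(x) s(g) = (g, g^-1(x)). *)
Require Import Defs.
From mathcomp Require Import all_boot.

Local Open Scope group_scope.

Lemma multiplicative1 (G H : groupType) (F : {multiplicative G -> H}) : F 1 = 1.
Proof. by apply: (mulgI (F 1)); rewrite -gmulfM !mulg1. Qed.

Lemma hol_sMi (K : groupType) (f : Aut K) (x : K) :
  hol_s f * hol_i x = HolPair f x.
Proof. by rewrite holM mulg1 aut_at1 mul1g. Qed.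

Lemma hol_iMs (K : groupType) (x : K) (f : Aut K) :
  hol_i x * hol_s f = HolPair f (f^-1 x).
Proof. by rewrite holM mul1g mulg1. Qed.

(** Stated for bare functions so that it also serves the converse, where [F] and [F'] carry no
    homomorphism structure; hence [F 1 = 1] must be derived. *)
Lemma hol_map_compatible (G H : groupType) (F : G -> H)
    (F' : Aut G -> Aut H) :
  {morph hol_map F F' : p q / p * q} -> compatible F F'.
Proof.
move=> FM.
(* Compare second components on i(x) s(g); the factor [F 1] comes from s(g) = (g, 1). *)
have FV (g : Aut G) x : F (g^-1 x) = (F' g)^-1 (F x) * F 1.
  by have := FM (hol_i x) (hol_s g); rewrite hol_iMs => -[].
have F1 : F 1 = 1.
  (* Cancelling [F 1] leaves [1 = (F' 1)^-1 (F 1)], and the automorphism [F' 1] fixes 1. *)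
  have := FV 1 1; rewrite aut_at1 -[X in X = _]mul1g => /mulIg e.
  by rewrite -(autVK (F' 1) (F 1)) -e aut_at1.
by move=> x g; rewrite -{1}(autK g x) FV F1 mulg1 autVK.
Qed.

Lemma compatible_hol_map (G H : groupType) (F : {multiplicative G -> H})
    (F' : {multiplicative Aut G -> Aut H}) :
  compatible F F' -> {morph hol_map F F' : p q / p * q}.
Proof.
move=> FF' [f x] [g y].
rewrite /hol_map !holM /= !gmulfM; congr (HolPair _ (_ * _)).
(* Compatibility at [g^-1 x] gives [F x = F' g (F (g^-1 x))]. *)
by rewrite -{2}(autVK g x) -FF' autK.
Qed.

Lemma split_ext_map_holE (G H : groupType) (F : G -> H)
    (F'' : Hol G -> Hol H) (F' : Aut G -> Aut H) :
  split_ext_map (hol_ext G) (hol_ext H) F F'' F' -> F'' =1 hol_map F F'.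
Proof.
move=> [_ FM _ Fi _ Fs] [f x].
by rewrite -hol_sMi FM (Fi x) (Fs f) !hol_sMi.
Qed.

Theorem theorem2p4p2 (G H : groupType) :
  (forall (F : {multiplicative G -> H}) (F' : {multiplicative Aut G -> Aut H}),
     ({morph hol_map F F' : p q / p * q} <-> compatible F F') /\
     (compatible F F' ->
        split_ext_map (hol_ext G) (hol_ext H) F (hol_map F F') F')) /\
  (forall (F : G -> H) (F'' : Hol G -> Hol H) (F' : Aut G -> Aut H),
     split_ext_map (hol_ext G) (hol_ext H) F F'' F' ->
     compatible F F' /\
     (forall (f : Aut G) (x : G), F'' (HolPair f x) = HolPair (F' f) (F x))).
Proof.
split=> [F F'|F F'' F' FF''].
  split; first by split; [exact: hol_map_compatible|exact: compatible_hol_map].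
  move=> FF'; split=> //.
  - exact: gmulfM.
  - exact: compatible_hol_map.
  - exact: gmulfM.
  (* The squares with i and s reduce to [F' 1 = 1] and [F 1 = 1]. *)
  - by move=> x; congr HolPair; apply: multiplicative1.
  - by move=> f; congr HolPair; apply: multiplicative1.
have FE := split_ext_map_holE _ _ _ _ _ FF''.
split=> [|f x]; last exact: FE.
(* [hol_map F F'] inherits multiplicativity from [F''], with which it agrees pointwise. *)
by apply: hol_map_compatible => p q; rewrite -!FE (sem_midM FF'').
Qed.
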